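(* Let $P$ be a closed polygonal curve embedded in $\mathbb{R}^3$ whose associated knot type $K$ has genus $g(K)$. If $t$ is the number of triangles in a triangulated oriented PL surface $S$ which is embedded in $\mathbb{R}^3$ and has a subdivision of $P$ as boundary, then $$t \geq 4g(K) + 1.$$
   Context: A closed polygonal curve embedded in $\mathbb{R}^3$ is a simple closed curve that is a finite cyclic union of straight line segments (edges). An embedded triangulated PL surface in $\mathbb{R}^3$ is a compact 2-manifold with boundary that is given as the union of a finite simplicial complex of (flat) triangles in $\mathbb{R}^3$. Having a subdivision of $P$ as boundary means that the boundary of the surface, as a point set, is exactly $P$, where extra vertices of the triangulation are allowed to lie on the edges of $P$. The genus $g(K)$ of a knot $K$ is the minimal genus of any connected orientable surface embedded in $\mathbb{R}^3$ that has the knot as its boundary; the genus of a connected orientable surface with one boundary circle is the genus of the closed surface obtained by gluing a disk to that circle. *)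

(* Defs.v *)
From HB Require Import structures.
From mathcomp Require Import all_boot all_order all_algebra all_fingroup.
From mathcomp Require Import all_classical all_reals all_analysis.

Set Implicit Arguments.
Unset Strict Implicit.
Unset Printing Implicit Defensive.

Import Order.TTheory GRing.Theory Num.Theory numFieldNormedType.Exports.

Local Open Scope ring_scope.

(* A pure 2-dimensional complex on V is given by its set T of triangles.
   Elements of V that lie in no triangle play no role. *)
Section Combinatorics.
Variable V : finType.
Implicit Types (T L : {set {set V}}) (s : seq V) (v : V).

Definition vertices T : {set V} := finset.cover T.

Definition edges T : {set {set V}} :=
  [set e : {set V} | (#|e| == 2%N) && [exists a in T, e \subset a]]%SET.

Definition boundary_edges T : {set {set V}} :=
  [set e in edges T | #|[set a in T | e \subset a]| == 1%N]%SET.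

Definition link T v : {set {set V}} := [set a :\ v | a in T & v \in a]%SET.

Definition is_arc L : Prop :=
  exists s, [/\ uniq s, (1 < size s)%N &
    L = [set:: [seq [set x.1; x.2]%SET | x <- zip s (behead s)]]%SET].

Definition is_circle L : Prop :=
  exists s, [/\ uniq s, (2 < size s)%N &
    L = [set:: [seq [set x.1; x.2]%SET | x <- zip s (rot 1 s)]]%SET].

(* Triangulated (combinatorial) 2-manifold with boundary: vertex links are
   circles (interior vertices) or arcs (boundary vertices). *)
Definition manifold2 T : Prop :=
  (forall a, a \in T -> #|a| = 3%N) /\
  (forall v, v \in vertices T -> is_circle (link T v) \/ is_arc (link T v)).

(* o a is a fixed-point-free permutation of the 3-set a, i.e. a cyclic order of
   its vertices; it orients the side {x, o a x} from x to o a x.  Two triangles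
   sharing a side must orient it in opposite directions. *)
Definition orientation T (o : {set V} -> {perm V}) : Prop :=
  (forall a x, a \in T -> x \in a -> o a x \in a /\ o a x != x) /\
  (forall a b x, a \in T -> b \in T -> a != b ->
     x \in a -> x \in b -> o a x \in b -> o b (o a x) = x).

Definition orientable T : Prop := exists o, orientation T o.

Definition euler_char T : int :=
  #|vertices T|%:Z - #|edges T|%:Z + #|T|%:Z.

(* From chi = 2 - 2 g; meaningful for closed connected orientable T. *)
Definition closed_genus T : rat := (2 - (euler_char T)%:~R) / 2.

End Combinatorics.

(* Gluing a disk to the boundary circle: the disk is the cone over this circle,
   with a new vertex None as apex. *)
Definition cap (V : finType) (T : {set {set V}}) : {set {set option V}} :=
  ([set (Some @: a)%SET | a : {set V} in T] :|:
   [set (None |: (Some @: e))%SET | e : {set V} in boundary_edges T])%SET.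

(* For T connected and orientable with a single boundary circle. *)
Definition genus (V : finType) (T : {set {set V}}) : rat := closed_genus (cap T).

Section Geometry.
Variable R : realType.
Local Notation point := 'rV[R]_3.

Definition hull (V : finType) (pos : V -> point) (s : {set V}) : set point :=
  (fun p => exists c : V -> R,
    [/\ forall v, v \in s -> 0 <= c v,
        \sum_(v in s) c v = 1 &
        p = \sum_(v in s) c v *: pos v]).

Definition affinely_independent (V : finType) (pos : V -> point)
    (s : {set V}) : Prop :=
  forall c : V -> R, \sum_(v in s) c v = 0 -> \sum_(v in s) c v *: pos v = 0 ->
    forall v, v \in s -> c v = 0.

Record complex := Complex {
  vtx : finType;
  pos : vtx -> point;
  triangles : {set {set vtx}} }.

(* The intersection condition for triangles implies it for all faces; for
   disjoint triangles, hull pos set0 is empty. *)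
Definition simplicial (C : complex) : Prop :=
  (forall a, a \in triangles C -> affinely_independent (@pos C) a) /\
  (forall a b, a \in triangles C -> b \in triangles C ->
     (hull (@pos C) a `&` hull (@pos C) b = hull (@pos C) (a :&: b)%SET)%classic).

Definition pl_surface (C : complex) : Prop :=
  simplicial C /\ manifold2 (triangles C).

Definition space (C : complex) : set point :=
  (fun p => exists2 a, a \in triangles C & hull (@pos C) a p).

Definition boundary (C : complex) : set point :=
  (fun p => exists2 e, e \in boundary_edges (triangles C) & hull (@pos C) e p).

(* A closed polygon is given by the cyclic sequence of its vertices. *)
Definition sides (P : seq point) : seq (point * point) := zip P (rot 1 P).

Definition on_side (e : point * point) (a : R) : point :=
  (1 - a) *: e.1 + a *: e.2.

Definition polygon (P : seq point) : set point :=
  (fun p => exists e a, [/\ e \in sides P, 0 <= a <= 1 & p = on_side e a]).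

(* Embeddedness: the piecewise linear parametrization of the polygon by
   half-open sides is injective. *)
Definition embedded_polygon (P : seq point) : Prop :=
  [/\ (2 < size P)%N, uniq P &
    forall e f a b, e \in sides P -> f \in sides P ->
      0 <= a < 1 -> 0 <= b < 1 -> on_side e a = on_side f b -> e = f /\ a = b].

Definition homeomorphism (f : point -> point) : Prop :=
  exists g : point -> point,
    [/\ cancel f g, cancel g f, continuous f & continuous g].

Definition ambient_isotopic (K K' : set point) : Prop :=
  exists H : R -> point -> point,
    [/\ ({within [set x : R * point | 0 <= x.1 <= 1],
           continuous (fun x : R * point => H x.1 x.2)})%classic,
        forall t, 0 <= t <= 1 -> homeomorphism (H t),
        forall p, H 0 p = p &
        (H 1 @` K)%classic = K'].

(* A Seifert surface of a representative of the knot type of K.  As usual, knot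
   theory is done in the PL category: the surfaces are PL. *)
Definition seifert_surface (K : set point) (F : complex) : Prop :=
  [/\ pl_surface F, connected (space F), orientable (triangles F) &
      ambient_isotopic K (boundary F)].

Definition has_knot_genus (K : set point) (g : nat) : Prop :=
  (exists2 F, seifert_surface K F & genus (triangles F) = g%:R) /\
  (forall F, seifert_surface K F -> g%:R <= genus (triangles F)).

End Geometry.

(* Main.v *)
(* Cutting off the components of S without boundary leaves a connected Seifert
   surface S' with F <= t triangles, so g(K) <= g(S'). Let E be its number of
   edges and b its number of boundary edges. Counting incidences gives
   2 E <= 3 F + b, and there are at least as many vertices as boundary
   vertices; inserted into the Euler characteristic of S' with a cone attached
   to its boundary, this yields 4 g(S') <= F + 2 - b. Finally b >= 3, because at
   each boundary vertex a second boundary edge leaves. *)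
Require Import Defs.
From mathcomp Require Import all_boot all_order all_algebra all_fingroup.
From mathcomp Require Import all_classical all_reals all_analysis.
From mathcomp Require Import zify.
Set Implicit Arguments.
Unset Strict Implicit.
Unset Printing Implicit Defensive.

Import Order.TTheory GRing.Theory Num.Theory numFieldNormedType.Exports.

(** * Vertex links, boundary edges and edge counts *)

Section Combinatorics.
Variable V : finType.
Import mathcomp.boot.fintype mathcomp.boot.finset.
Implicit Types (T L : {set {set V}}) (s : seq V).
Local Open Scope nat_scope.
Local Open Scope set_scope.

(** Removing [x] is a bijection from the triangles through both vertices to the link edges at [u].
    Being a boundary edge thus becomes a property of a vertex in a link. *)
Lemma card_subset_triangles T (x u : V) : u != x ->
  #|[set a in T | [set x; u] \subset a]| = #|[set l in link T x | u \in l]|.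
Proof.
move=> ux.
have -> : [set l in link T x | u \in l] =
          [set a :\ x | a in [set a in T | [set x; u] \subset a]].
  apply/setP => l; rewrite inE; apply/andP/imsetP.
    case=> /imsetP[a]; rewrite inE => /andP[aT xa] -> /setD1P[_ ua].
    by exists a => //; rewrite inE aT subUset !sub1set xa ua.
  case=> a; rewrite inE subUset !sub1set => /and3P[aT xa ua] ->; split.
    by apply/imsetP; exists a => //; rewrite inE aT.
  by rewrite !inE ux.
rewrite card_in_imset// => a b; rewrite !inE !subUset !sub1set.
by move=> /and3P[_ xa _] /and3P[_ xb _] ab; rewrite -(setD1K xa) ab setD1K.
Qed.

Lemma mem_arc_edges (x0 : V) s (l : {set V}) :
  reflect (exists2 i, i.+1 < size s & l = [set nth x0 s i; nth x0 s i.+1])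
    (l \in [set:: [seq [set x.1; x.2] | x <- zip s (behead s)]]).
Proof.
have sz : size (zip s (behead s)) = (size s).-1.
  by rewrite size_zip size_behead; apply/minn_idPr/leq_pred.
rewrite inE; apply: (iffP mapP).
  case=> -[a b] /(nthP (x0, x0)) [i]; rewrite sz => Hi.
  rewrite nth_zip_cond sz Hi nth_behead => -[<- <-] ->.
  by exists i; rewrite -?ltn_predRL.
case=> i; rewrite -ltn_predRL => Hi ->.
exists (nth x0 s i, nth x0 s i.+1) => //.
by apply/(nthP (x0, x0)); exists i; rewrite ?nth_zip_cond sz ?Hi ?nth_behead.
Qed.

(** The first and last vertices of the path lie on one edge each; they differ because the path has
    at least two vertices. *)
Lemma arc_ends L : is_arc L -> exists u v,
  [/\ u != v, #|[set l in L | u \in l]| = 1 & #|[set l in L | v \in l]| = 1].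
Proof.
case=> s [us ss ->].
have x0 : V by case: s ss {us}.
have nthE i j : i < size s -> j < size s ->
  (nth x0 s i == nth x0 s j) = (i == j) by move=> si sj; rewrite nth_uniq.
exists (nth x0 s 0), (nth x0 s (size s).-1); split.
- by rewrite nthE; lia.
- apply/eqP/cards1P; exists [set nth x0 s 0; nth x0 s 1].
  apply/setP => l; rewrite in_set [in RHS]inE; apply/andP/eqP.
    case=> /(mem_arc_edges x0)[i Hi ->].
    by rewrite !inE !nthE; try lia; case/orP=> /eqP // <-.
  move=> ->; split; last by rewrite !inE eqxx.
  by apply/(mem_arc_edges x0); exists 0.
- apply/eqP/cards1P.
  exists [set nth x0 s (size s).-2; nth x0 s (size s).-1].
  apply/setP => l; rewrite in_set [in RHS]inE; apply/andP/eqP.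
    case=> /(mem_arc_edges x0)[i Hi ->].
    rewrite !inE !nthE; try lia.
    by case/orP => /eqP E; [lia|rewrite E].
  move=> ->; split; last by rewrite !inE eqxx orbT.
  apply/(mem_arc_edges x0); exists (size s).-2; first lia.
  by rewrite prednK//; lia.
Qed.

(** A vertex of the cycle lies on the edges to its successor and to its predecessor, which are
    distinct because the cycle has at least three vertices. *)
Lemma circle_no_end L u : is_circle L -> #|[set l in L | u \in l]| <> 1.
Proof.
case=> s [us ss defL] /eqP/cards1P[m defm].
have um : (m \in L) && (u \in m) by move/setP: defm => /(_ m); rewrite !inE eqxx.
have uniqm l : l \in L -> u \in l -> l = m.
  by move=> lL ul; apply/eqP; move/setP: defm => /(_ l); rewrite !inE lL ul => <-.
have us' : u \in s.
  case/andP: um; rewrite defL inE => /mapP[[a b] /= ab ->].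
  have /andP[a_s b_s] : (a \in s) && (b \in s).
    move: ab => /(nthP (a, b)) [i]; rewrite size_zip size_rot minnn => Hi.
    rewrite nth_zip ?size_rot// => -[Ea Eb].
    by rewrite -{1}Ea mem_nth// -Eb -(mem_rot 1) mem_nth// size_rot.
  by rewrite !inE => /orP[] /eqP ->.
have pair i : i < size s ->
    [set nth u s i; nth u (rot 1 s) i] \in L.
  move=> Hi; rewrite defL inE; apply/mapP.
  exists (nth u s i, nth u (rot 1 s) i) => //.
  rewrite -nth_zip ?size_rot//; apply: mem_nth.
  by rewrite size_zip size_rot minnn.
have nth_rot1 i : i < size s -> nth u (rot 1 s) i = nth u s (i.+1 %% size s).
  case: (s) => [//|z s'] Hi; rewrite rot1_cons nth_rcons /=.
  move: Hi; rewrite /= ltnS leq_eqVlt => /orP[/eqP->|Hi].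
    by rewrite ltnn eqxx modnn.
  by rewrite Hi modn_small// ltnS.
have nthE i j : i < size s -> j < size s ->
  (nth u s i == nth u s j) = (i == j) by move=> si sj; rewrite nth_uniq.
have n0 : 0 < size s by lia.
set n := size s in ss n0 pair nth_rot1 nthE; set i := index u s.
have Hi : i < n by rewrite index_mem.
have Ei : nth u s i = u by rewrite nth_index.
(* [j] is the cyclic predecessor of [i]; adding [n.-1] modulo [n] also covers [i = 0]. *)
pose j := (i + n.-1) %% n.
have Hj : j < n by rewrite ltn_mod; lia.
have Ej : j.+1 %% n = i.
  rewrite -addn1 modnDml -addnA addn1 prednK; last lia.
  by rewrite modnDr modn_small.
have mi := uniqm _ (pair _ Hi); have mj := uniqm _ (pair _ Hj).
rewrite !inE (nth_rot1 _ Hi) Ei eqxx in mi.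
rewrite !inE (nth_rot1 _ Hj) Ej Ei eqxx orbT in mj.
(* Both edges at [u] equal [m], so the predecessor of [u] would be [u] itself or its successor; this
   is impossible modulo [n > 2]. *)
have : [set nth u s i; nth u s (i.+1 %% n)] = [set nth u s j; nth u s i].
  by rewrite Ei (mi isT) (mj isT).
move/setP/(_ (nth u s j)); rewrite !inE eqxx /= !nthE ?ltn_mod//.
have [Hlt|Hge] := ltnP i.+1 n.
  rewrite (modn_small Hlt) => /orP[] /eqP E; move: Ej; rewrite E.
    by rewrite modn_small//; lia.
  have [H2|H2] := ltnP i.+2 n; first by rewrite modn_small//; lia.
  by rewrite (_ : i.+2 = n) ?modnn; lia.
have E1 : i.+1 = n by lia.
rewrite E1 modnn => /orP[] /eqP E; move: Ej; rewrite E.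
  by rewrite E1 modnn; lia.
by rewrite modn_small; lia.
Qed.

Lemma boundary_edge_end T (x u : V) : u != x ->
  ([set x; u] \in boundary_edges T) = (#|[set l in link T x | u \in l]| == 1).
Proof.
move=> ux; rewrite inE card_subset_triangles//.
case: eqP => [E|]; rewrite ?andbF// andbT inE cards2 (eq_sym x u) ux /=.
(* A positive count supplies the triangle that membership in [edges] asks for. *)
have : 0 < #|[set l in link T x | u \in l]| by rewrite E.
rewrite -card_subset_triangles// => /card_gt0P[a]; rewrite inE => aH.
by apply/existsP; exists a.
Qed.

(** The vertex [y] is an end of the link of [x], so this link is an arc and not a circle; its other
    end serves as [z]. *)
Lemma boundary_edge_next T (x y : V) : manifold2 T -> x != y ->
  [set x; y] \in boundary_edges T ->
  exists2 z, [set x; z] \in boundary_edges T & (z != x) && (z != y).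
Proof.
move=> [_ mT] xy; rewrite boundary_edge_end; last by rewrite eq_sym.
move=> /eqP Hy.
have xT : x \in vertices T.
  have : 0 < #|[set l in link T x | y \in l]| by rewrite Hy.
  case/card_gt0P=> l; rewrite inE => /andP[/imsetP[a]].
  rewrite inE => /andP[aT xa] _ _.
  by apply/bigcupP; exists a.
case: (mT x xT) => [circ|/arc_ends[u [v [uv Hu Hv]]]].
  by case: (circle_no_end circ Hy).
have ne w : #|[set l in link T x | w \in l]| = 1 -> w != x.
  move=> Hw; have : 0 < #|[set l in link T x | w \in l]| by rewrite Hw.
  case/card_gt0P=> l; rewrite inE => /andP[/imsetP[a _ ->]].
  by case/setD1P.
have [uy|nuy] := eqVneq u y.
  by exists v; rewrite ?boundary_edge_end ?Hv ?ne// -uy eq_sym.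
by exists u; rewrite ?boundary_edge_end ?Hu ?ne// nuy.
Qed.

(** A boundary edge [{x, y}] continues by [{x, z}] at [x] and by [{y, w}] at [y]. The vertices [z]
    and [w] may coincide, but the three edges differ. *)
Lemma card_boundary_edges T : manifold2 T -> boundary_edges T != set0 ->
  3 <= #|boundary_edges T|.
Proof.
move=> mT /set0Pn[e eB].
have /cards2P[x [y [xy exy]]] : #|e| == 2 by move: eB; rewrite !inE => /andP[/andP[]].
rewrite exy in eB.
have [z zB /andP[zx zy]] := boundary_edge_next mT xy eB.
have yx : y != x by rewrite eq_sym.
have [|w wB /andP[wy wx]] := boundary_edge_next mT yx; first by rewrite setUC.
apply: (@leq_trans #|[set [set x; y]; [set x; z]; [set y; w]]|).
  rewrite -setUA !cardsU1 cards1 !inE.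
  have -> : ([set x; y] == [set x; z]) = false.
    apply/eqP => /setP /(_ y); rewrite !inE eqxx orbT (negPf yx).
    by rewrite (eq_sym y z) (negPf zy).
  have -> : ([set x; y] == [set y; w]) = false.
    apply/eqP => /setP /(_ x); rewrite !inE eqxx (negPf xy).
    by rewrite (eq_sym x w) (negPf wx).
  have -> : ([set x; z] == [set y; w]) = false => //.
  apply/eqP => /setP /(_ x); rewrite !inE eqxx (negPf xy).
  by rewrite (eq_sym x w) (negPf wx).
by apply: subset_leq_card; apply/subsetP => f; rewrite !inE -orbA =>
  /or3P[] /eqP ->; move: eB zB wB; rewrite !inE.
Qed.

(** Double counting of the incidences between edges and triangles: each triangle contributes its
    three 2-element subsets. *)
Lemma double_card_edges T : (forall a, a \in T -> #|a| = 3) ->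
  2 * #|edges T| <= 3 * #|T| + #|boundary_edges T|.
Proof.
move=> T3.
have <- : \sum_(e in edges T) #|[set a in T | e \subset a]| = 3 * #|T|.
  under eq_bigr => e _.
    rewrite -sum1_card.
    under eq_bigl => a do rewrite inE.
    over.
  rewrite (exchange_big_dep (mem T)) /=; last by move=> e a _ /andP[].
  rewrite mulnC -sum_nat_const; apply: eq_bigr => a aT.
  have <- : #|[set e : {set V} | e \subset a & #|e| == 2]| = 3.
    by rewrite cards_draws T3.
  rewrite -sum1_card.
  apply: eq_bigl => e; rewrite !inE aT andTb andbC; case ea: (e \subset a) => //=.
  by rewrite andb_idr// => _; apply/existsP; exists a; rewrite aT.
have -> : #|boundary_edges T| =
    \sum_(e in edges T) (#|[set a in T | e \subset a]| == 1).
  rewrite -sum1_card [RHS]big_mkcond [LHS]big_mkcond; apply: eq_bigr => e _.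
  by rewrite inE; case: (e \in edges T) => //=; case: eqP.
(* Every edge lies in some triangle; if only in one, the indicator of boundary edges adds the
   missing unit. *)
rewrite -big_split /= mulnC -sum_nat_const; apply: leq_sum => e.
rewrite inE => /andP[_ /existsP[a /andP[aT ea]]].
have : 0 < #|[set a in T | e \subset a]|.
  by apply/card_gt0P; exists a; rewrite inE aT.
by case: #|_| => [//|[|n]].
Qed.

(** * The cone over the boundary *)

Definition boundary_vertices T : {set V} := cover (boundary_edges T).

Lemma boundary_vertices_sub T : boundary_vertices T \subset vertices T.
Proof.
apply/bigcupsP => e; rewrite inE => /andP[]; rewrite inE => /andP[_].
case/existsP=> a /andP[aT ea] _; apply: (subset_trans ea).
exact: bigcup_sup.
Qed.

Let Some_inj : injective (@Some V). Proof. by move=> x y []. Qed.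

Lemma imset_Some_inj : injective (fun a : {set V} => Some @: a).
Proof. exact: imset_inj. Qed.

(** The apex [None] lies in every added triangle and in no original one, so the union is disjoint;
    removing the apex recovers the boundary edge below it. *)
Lemma card_cap T : #|cap T| = #|T| + #|boundary_edges T|.
Proof.
have NS (a : {set V}) : None \notin Some @: a by apply/negP => /imsetP[].
rewrite /cap cardsU [X in _ - X](_ : _ = 0).
  rewrite subn0 (card_imset _ imset_Some_inj) card_in_imset// => a b _ _ ab.
  by apply: imset_Some_inj; rewrite -(setU1K (NS a)) ab setU1K.
apply/eqP; rewrite cards_eq0; apply/eqP/setP => c; rewrite !inE.
apply/negP => /andP[/imsetP[a _ ->] /imsetP[e _ /setP/(_ None)]].
by rewrite !inE eqxx (negPf (NS a)).
Qed.

(** A lower bound suffices, since vertices enter the Euler characteristic positively. A boundary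
    edge puts the apex into some triangle. *)
Lemma card_vertices_cap T : boundary_edges T != set0 ->
  #|vertices T| + 1 <= #|vertices (cap T)|.
Proof.
case/set0Pn=> e eB; rewrite -(card_imset _ Some_inj).
have NS : None \notin Some @: vertices T by apply/negP => /imsetP[].
apply: (@leq_trans #|None |: Some @: vertices T|).
  by rewrite cardsU1 NS addnC.
apply: subset_leq_card.
apply/subsetP => w /setU1P[->|/imsetP[v /bigcupP[a aT va] ->]]; apply/bigcupP.
  exists (None |: Some @: e); last by rewrite setU11.
  by apply/setUP; right; apply/imsetP; exists e.
exists (Some @: a); last exact: imset_f.
by apply/setUP; left; apply/imsetP; exists a.
Qed.

(** An upper bound suffices, since edges enter negatively. An edge through the apex joins it to a
    boundary vertex; any other edge comes from [T]. *)
Lemma card_edges_cap T :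
  #|edges (cap T)| <= #|edges T| + #|boundary_vertices T|.
Proof.
pose E1 := (fun a : {set V} => Some @: a) @: edges T.
pose E2 := (fun v : V => [set None; Some v]) @: boundary_vertices T.
apply: (@leq_trans #|E1 :|: E2|).
  apply: subset_leq_card; apply/subsetP => f; rewrite inE => /andP[f2].
  case/existsP=> c /andP[cT fc].
  have [Nf|Nf] := boolP (None \in f).
    apply/setUP; right.
    have [v fv] : exists v, f :\ None = [set v].
      by apply/cards1P; move: f2; rewrite (cardsD1 None f) Nf.
    have [w vw] : exists w, v = Some w.
      have : v \in f :\ None by rewrite fv set11.
      by rewrite !inE; case: v {fv} => [w _|//]; exists w.
    apply/imsetP; exists w; last by rewrite -vw -fv setD1K.
    have wc : Some w \in c.
      apply: (subsetP fc); have : v \in f :\ None by rewrite fv set11.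
      by rewrite vw => /setD1P[].
    case/setUP: cT => /imsetP[e eT ce].
      by move/(subsetP fc): Nf; rewrite ce => /imsetP[].
    apply/bigcupP; exists e => //; move: wc; rewrite ce.
    by case/setU1P=> // /imsetP[w' ? [->]].
  apply/setUP; left; pose d := [set v | Some v \in f].
  have fd : f = Some @: d.
    apply/setP => -[w|]; last by rewrite (negPf Nf); symmetry; apply/negP => /imsetP[].
    by rewrite mem_imset// inE.
  apply/imsetP; exists d => //; rewrite inE -(card_imset _ Some_inj) -fd f2 /=.
  (* Without the apex, an edge of a cone triangle sits in its base, a boundary edge, and hence in a
     triangle of [T]. *)
  case/setUP: cT => /imsetP[a aT ca]; last first.
    move: aT; rewrite inE => /andP[]; rewrite inE => /andP[_].
    case/existsP=> b /andP[bT ab] _; apply/existsP; exists b; rewrite bT /=.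
    apply: subset_trans ab; apply/subsetP => v; rewrite inE.
    move/(subsetP fc); rewrite ca => /setU1P[//|/imsetP[w ? [->]]] //.
  apply/existsP; exists a; rewrite aT /=; apply/subsetP => v; rewrite inE.
  by move/(subsetP fc); rewrite ca mem_imset.
apply: leq_trans (leq_card_setU _ _) _.
by apply: leq_add; apply: leq_imset_card.
Qed.

(** Let [T] have [E] edges, [F] triangles and [b] boundary edges. Since boundary vertices are
    vertices, the cap has Euler characteristic at least [1 - E + F + b]. Hence [4 g <= 2 + 2 E - 2 F
    - 2 b <= F + 2 - b <= F - 1]. *)
Lemma genus_le_card T (g : nat) : manifold2 T -> boundary_edges T != set0 ->
  (g%:R <= genus T)%R -> 4 * g + 1 <= #|T|.
Proof.
move=> mT B0; rewrite /genus /closed_genus ler_pdivlMr// => gT.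
have {gT} : ((g * 2)%:Z + euler_char (cap T) <= 2)%R.
  by rewrite -(ler_int rat) rmorphD /= -lerBrDr -pmulrn natrM.
rewrite /euler_char card_cap.
have := card_vertices_cap B0; have := card_edges_cap T.
have := double_card_edges mT.1; have := card_boundary_edges mT B0.
have := subset_leq_card (boundary_vertices_sub T).
lia.
Qed.

End Combinatorics.

(** * Connected components of a complex *)

Section Components.
Variable V : finType.
Import mathcomp.boot.fintype mathcomp.boot.finset.
Implicit Types (T A : {set {set V}}).
Local Open Scope nat_scope.
Local Open Scope set_scope.

(** Closure under meeting triangles is used because it passes to the complement, which need not be a
    single component. *)
Definition union_of_components T A : Prop :=
  A \subset T /\
  forall a b, a \in A -> b \in T -> ~~ [disjoint a & b] -> b \in A.

Definition component T (a : {set V}) : {set {set V}} :=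
  [set b | connect [rel b c | [&& b \in T, c \in T & ~~ [disjoint b & c]]] a b].

Lemma component_id T a : a \in component T a.
Proof. by rewrite inE connect0. Qed.

Lemma component_sub T a : a \in T -> component T a \subset T.
Proof.
move=> aT; apply/subsetP => b; rewrite inE => /connectP[p].
elim: p a aT => [|c p IH] a aT /=; first by move=> _ ->.
by case/andP=> /and3P[_ cT _] cp; apply: IH.
Qed.

Lemma component_union T a : a \in T -> union_of_components T (component T a).
Proof.
move=> aT; split=> [|b c bA cT bc]; first exact: component_sub.
have bT := subsetP (component_sub aT) b bA.
move: bA; rewrite !inE => ab; apply: connect_trans ab (connect1 _).
by rewrite /= bT cT.
Qed.

Lemma union_of_componentsD T A :
  union_of_components T A -> union_of_components T (T :\: A).
Proof.
move=> [_ sat]; split=> [|a b]; first exact: subsetDl.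
case/setDP=> aT aA bT ab; rewrite inE bT andbT; apply: contra aA => bA.
by apply: sat bA aT _; rewrite disjoint_sym.
Qed.

Section Saturated.
Variables (T A : {set {set V}}).
Hypothesis compA : union_of_components T A.

Lemma mem_component_containing (v : V) (a b : {set V}) :
  v \in a -> v \in b -> a \in A -> b \in T -> b \in A.
Proof.
move=> va vb aA bT; apply: (compA.2 _ _ aA bT).
by apply/pred0Pn; exists v; rewrite /= va.
Qed.

(** The link involves only the triangles at [v], and [A] contains all of them once it contains
    one. *)
Lemma link_component (v : V) : v \in vertices A -> link A v = link T v.
Proof.
case/bigcupP=> a aA va; rewrite /link; congr (_ @: pred_of_set _).
apply/setP => b; rewrite !inE; apply: andb_id2r => vb; apply/idP/idP.
  exact: subsetP compA.1 b.
exact: mem_component_containing va vb aA.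
Qed.

Lemma manifold2_component : manifold2 T -> manifold2 A.
Proof.
move=> [T3 Tl]; split=> [a /(subsetP compA.1)/T3//|v vA].
rewrite link_component//; apply: Tl; case/bigcupP: vA => a aA va.
by apply/bigcupP; exists a => //; apply: subsetP compA.1 a aA.
Qed.

(** All triangles containing [e] share its vertices, so they lie in [A] along with [a], and the
    counts defining boundary edges agree. *)
Lemma boundary_edges_component (e a : {set V}) : a \in A -> e \subset a ->
  (e \in boundary_edges A) = (e \in boundary_edges T).
Proof.
move=> aA ea; have aT := subsetP compA.1 a aA.
rewrite !inE; have [e2|] := boolP (#|e| == 2) => //=.
have /card_gt0P[v ve] : 0 < #|e| by rewrite (eqP e2).
have -> : [exists a in A, e \subset a] by apply/existsP; exists a; rewrite aA.
have -> : [exists a in T, e \subset a] by apply/existsP; exists a; rewrite aT.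
congr (#|pred_of_set _| == _); apply/setP => b; rewrite !inE.
apply: andb_id2r => eb; apply/idP/idP; first exact: subsetP compA.1 b.
exact: mem_component_containing (subsetP ea v ve) (subsetP eb v ve) aA.
Qed.

End Saturated.
End Components.

(** * Topology of segments and polygons *)

Section Segments.
Variable R : realType.
Local Notation point := 'rV[R]_3.
Local Open Scope classical_set_scope.
Local Open Scope ring_scope.

Definition segment (p q : point) : set point :=
  [set on_side (p, q) a | a in `[0, 1]%classic].

Lemma continuous_on_side (p q : point) :
  continuous (on_side (p, q) : R -> point).
Proof.
move=> a; rewrite /on_side /=; apply: cvgD; apply: cvgZr_tmp => //.
by apply: cvgB => //; apply: cvg_cst.
Qed.

Lemma segment_left (p q : point) : segment p q p.
Proof.
exists 0; first by rewrite /= in_itv /= lexx ler01.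
by rewrite /on_side /= subr0 scale1r scale0r addr0.
Qed.

Lemma segment_right (p q : point) : segment p q q.
Proof.
exists 1; first by rewrite /= in_itv /= lexx ler01.
by rewrite /on_side /= subrr scale1r scale0r add0r.
Qed.

Lemma connected_segment (p q : point) : connected (segment p q).
Proof.
apply: connected_continuous_connected; first exact: segment_connected.
exact/continuous_subspaceT/continuous_on_side.
Qed.

Lemma closed_segment (p q : point) : closed (segment p q).
Proof.
apply: compact_closed; first exact: norm_hausdorff.
apply: continuous_compact; last exact: segment_compact.
exact/continuous_subspaceT/continuous_on_side.
Qed.

(** Keeping the final point [y] apart from the intermediate vertices [s] allows induction on [s]; a
    closed polygon is the case [y = x]. *)
Definition polygonal_path (x : point) (s : seq point) (y : point) : set point :=
  \bigcup_(e in [set` zip (x :: s) (rcons s y)]) segment e.1 e.2.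

Lemma polygonal_path_start x s y : polygonal_path x s y x.
Proof.
by case: s => [|z s]; [exists (x, y)|exists (x, z)];
  rewrite /= ?mem_head//; exact: segment_left.
Qed.

Lemma connected_polygonal_path x s y : connected (polygonal_path x s y).
Proof.
elim: s x => [|z s IH] x.
  rewrite (_ : polygonal_path _ _ _ = segment x y); first exact: connected_segment.
  apply/seteqP; split=> [p [e]|p xyp]; first by rewrite /= inE => /eqP ->.
  by exists (x, y); rewrite //= mem_head.
rewrite (_ : polygonal_path _ _ _ = segment x z `|` polygonal_path z s y).
  apply: connectedU (@connected_segment _ _) (IH z).
  by exists z; split; [exact: segment_right|exact: polygonal_path_start].
apply/seteqP; split=> p.
  case=> e; rewrite /= inE => /orP[/eqP->|es]; first by left.
  by move=> ep; right; exists e.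
case=> [xzp|[e es ep]]; first by exists (x, z); rewrite //= mem_head.
by exists e; rewrite //= inE es orbT.
Qed.

Lemma polygonE x s : polygon (x :: s) = polygonal_path x s x.
Proof.
rewrite /polygon /sides rot1_cons; apply/seteqP; split=> p.
  case=> -[q r] [a [es a01 ->]]; exists (q, r) => //; exists a => //=.
case=> -[q r] es [a]; rewrite /= in_itv /= => a01 <-.
by exists (q, r), a.
Qed.

Lemma connected_polygon (P : seq point) : connected (polygon P).
Proof.
case: P => [|x s]; last by rewrite polygonE; exact: connected_polygonal_path.
rewrite (_ : polygon _ = set0); first exact: connected0.
by rewrite -subset0 => p [e [a []]].
Qed.

Lemma polygon_nonempty (P : seq point) : (0 < size P)%N -> polygon P !=set0.
Proof.
by case: P => // x s _; exists x; rewrite polygonE; exact: polygonal_path_start.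
Qed.

End Segments.

(** * Convex hulls of faces *)

Section Hulls.
Variables (R : realType) (V : finType) (pos : V -> 'rV[R]_3).
Local Open Scope classical_set_scope.
Local Open Scope ring_scope.

Lemma hull_set0 : hull pos finset.set0 = set0.
Proof.
rewrite -subset0 => p [c [_ /eqP]].
by rewrite big_set0 eq_sym oner_eq0.
Qed.

(** The coefficients are extended by zero outside [a]. *)
Lemma hullS (a b : {set V}) : a \subset b -> hull pos a `<=` hull pos b.
Proof.
move=> ab p [c [c0 c1 ->]]; exists (fun v => if v \in a then c v else 0).
have sum_sub (U : zmodType) (F : V -> U) :
    \sum_(v in b) (if v \in a then F v else 0) = \sum_(v in a) F v.
  rewrite -big_mkcondr; apply: eq_bigl => v.
  by rewrite andb_idl// => /(fintype.subsetP ab).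
split; [|by rewrite sum_sub|].
- by move=> v _; case: ifP => // /c0.
- by rewrite -sum_sub; apply: eq_bigr => v _; case: ifP => //; rewrite scale0r.
Qed.

Lemma hull_vertex (a : {set V}) v : v \in a -> hull pos a (pos v).
Proof.
move=> va; exists (fun w => (w == v)%:R); split.
- by move=> w _; rewrite ler0n.
- rewrite (bigD1 v)//= eqxx big1 ?addr0// => w /andP[_ /negPf ->] //.
- rewrite (bigD1 v)//= eqxx scale1r big1 ?addr0// => w /andP[_ /negPf ->].
  by rewrite scale0r.
Qed.

Lemma hull_convex (a : {set V}) p q :
  hull pos a p -> hull pos a q -> segment p q `<=` hull pos a.
Proof.
move=> [c [c0 c1 ->]] [d [d0 d1 ->]] z [t] /=; rewrite in_itv /= => /andP[t0 t1] <-.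
exists (fun v => (1 - t) * c v + t * d v); split.
- by move=> v va; rewrite addr_ge0// mulr_ge0 ?subr_ge0 ?c0 ?d0.
- by rewrite big_split/= -!mulr_sumr c1 d1 !mulr1 subrK.
- rewrite /on_side /= !scaler_sumr -big_split /=; apply: eq_bigr => v _.
  by rewrite !scalerA -scalerDl.
Qed.

(** A nonempty hull is the union of the segments from one of its vertices to its points. *)
Lemma connected_hull (a : {set V}) : connected (hull pos a).
Proof.
have [->|[v va]] := set_0Vmem a; first by rewrite hull_set0; exact: connected0.
rewrite (_ : hull pos a = \bigcup_(q in hull pos a) segment (pos v) q).
  apply: bigcup_connected => [|q _]; last exact: connected_segment.
  by exists (pos v) => q _; exact: segment_left.
apply/seteqP; split=> [p ap|p [q aq]]; first by exists p => //; exact: segment_right.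
exact/hull_convex/aq/hull_vertex.
Qed.

Lemma hull_edge (x y : V) : x != y ->
  hull pos [set x; y]%SET = segment (pos x) (pos y).
Proof.
move=> xy; apply/seteqP; split.
  move=> p [c [c0]]; rewrite !big_setU1 ?big_set1 ?inE//= => c1 ->.
  (* The coefficient of [y] is the parameter along the segment. *)
  exists (c y); last by rewrite /on_side /= -c1 addrK.
  by rewrite /= in_itv /= c0 ?inE ?eqxx ?orbT//= -c1 lerDr c0// !inE eqxx.
by apply: hull_convex; apply: hull_vertex; rewrite !inE eqxx ?orbT.
Qed.

Lemma closed_hull_edge (e : {set V}) : #|e| = 2%N -> closed (hull pos e).
Proof.
by move=> /eqP/finset.cards2P[x [y [xy ->]]]; rewrite hull_edge//; exact: closed_segment.
Qed.

End Hulls.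

(** * Spaces and boundaries of subcomplexes *)

Section Surfaces.
Variables (R : realType) (S : complex R).
Local Open Scope classical_set_scope.
Local Open Scope ring_scope.

(** Vertex type and positions are kept, so hulls in the subcomplex are literally those in [S]. *)
Definition subcomplex (A : {set {set vtx S}}) : complex R := Complex (@pos R S) A.

Lemma closed_boundary : closed (boundary S).
Proof.
rewrite (_ : boundary S =
    \bigcup_(e in [set` boundary_edges (triangles S)]) hull (@pos R S) e) //.
apply: closed_bigcup => [|e]; first exact: finite_finset.
by rewrite /= !finset.inE => /andP[/andP[/eqP e2 _] _]; exact: closed_hull_edge.
Qed.

Lemma boundary_edge_sub (T : {set {set vtx S}}) e : e \in boundary_edges T ->
  exists2 a, a \in T & e \subset a.
Proof.
rewrite finset.inE => /andP[]; rewrite finset.inE => /andP[_ /existsP[a]].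
by case/andP; exists a.
Qed.

Lemma boundary_sub_space (p : 'rV[R]_3) : boundary S p -> Defs.space S p.
Proof.
by case=> e /boundary_edge_sub[a aT ea] ep; exists a => //; exact: hullS ep.
Qed.

Lemma simplicial_subcomplex (A : {set {set vtx S}}) : A \subset triangles S ->
  simplicial S -> simplicial (subcomplex A).
Proof.
move=> /fintype.subsetP AT [ind int]; split=> [a /AT/ind//|a b /AT aT /AT bT].
exact: int.
Qed.

Lemma pl_surface_component (A : {set {set vtx S}}) :
  union_of_components (triangles S) A -> pl_surface S ->
  pl_surface (subcomplex A).
Proof.
move=> compA [simpS manS]; split; last exact: manifold2_component compA manS.
exact: simplicial_subcomplex compA.1 simpS.
Qed.

(** A triangle of [A] and one outside share no vertex, so by the simplicial condition they meet in
    the hull of the empty face, which is empty. *)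
Lemma space_component_disjoint (A : {set {set vtx S}}) :
  simplicial S -> union_of_components (triangles S) A ->
  Defs.space (subcomplex A) `&`
  Defs.space (subcomplex (triangles S :\: A)%SET) = set0.
Proof.
move=> [_ int] compA; rewrite -subset0 => p [[a /= aA ap] [b]].
rewrite /= => /setDP[bT bA] bp.
have ab : [disjoint a & b]%B by apply: contraR bA => /(compA.2 _ _ aA bT).
have aT := fintype.subsetP compA.1 a aA.
have : (hull (@pos R S) a `&` hull (@pos R S) b) p by [].
by rewrite int// (disjoint_setI0 ab) hull_set0.
Qed.

Lemma boundary_components (A : {set {set vtx S}}) :
  union_of_components (triangles S) A ->
  boundary S = boundary (subcomplex A) `|`
               boundary (subcomplex (triangles S :\: A)%SET).
Proof.
move=> compA; have compD := union_of_componentsD compA.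
apply/seteqP; split=> [p [e eB ep]|p [[e eB ep]|[e eB ep]]].
- have [a aT ea] := boundary_edge_sub eB.
  have [aA|aA] := boolP (a \in A); [left|right]; exists e => //=.
    by rewrite (boundary_edges_component compA aA ea).
  by rewrite (boundary_edges_component compD _ ea)// finset.inE aA aT.
- have [a aA ea] := boundary_edge_sub eB; exists e => //.
  by rewrite -(boundary_edges_component compA aA ea).
- have [a aA ea] := boundary_edge_sub eB; exists e => //.
  by rewrite -(boundary_edges_component compD aA ea).
Qed.

(** A chain of successively meeting triangles has a connected union, and the chains starting at [a]
    all contain the hull of [a]. *)
Lemma connected_space_component (a : {set vtx S}) : a != finset.set0 ->
  a \in triangles S ->
  connected (Defs.space (subcomplex (component (triangles S) a))).
Proof.
move=> /set0Pn[v va] aT; set A := component _ _.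
have compA : union_of_components (triangles S) A := component_union aT.
(* [C] stands for the union of a chain from [b] to [c]; only these four properties of it matter. *)
pose joins b c (C : set 'rV[R]_3) :=
  [/\ connected C, C `<=` Defs.space (subcomplex A),
      hull (@pos R S) b `<=` C & hull (@pos R S) c `<=` C].
have pathP p b : b \in A ->
    path [rel b c | [&& b \in triangles S, c \in triangles S &
                        ~~ [disjoint b & c]%B]] b p ->
    exists C, joins b (last b p) C.
  elim: p b => [|c p IH] b bA /=.
    by exists (hull (@pos R S) b); split=> //; [exact: connected_hull | exists b].
  case/andP=> /and3P[bT cT bc]; have cA := compA.2 _ _ bA cT bc.
  case/(IH c cA) => C [conC CA cC lC].
  have /existsP[w /andP[wb wc]] : [exists w, (w \in b) && (w \in c)].
    by apply: contraR bc => /existsPn nbc; apply/pred0P => w; exact/negbTE/nbc.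
  exists (hull (@pos R S) b `|` C); split.
  - apply: connectedU (@connected_hull _ _ _ _) conC.
    by exists (pos w); split; [|apply: cC]; exact: hull_vertex.
  - by move=> q [bq|/CA//]; exists b.
  - exact: subsetUl.
  - by move=> q /lC Cq; right.
pose family (C : set 'rV[R]_3) := exists b, joins a b C.
rewrite (_ : Defs.space _ = \bigcup_(C in family) C).
  apply: bigcup_connected => [|C [b []]//].
  by exists (pos v) => C [b [_ _ aC _]]; apply: aC; exact: hull_vertex.
apply/seteqP; split=> [q [b bA bq]|q [C [b [_ CA _ _]] /CA//]].
have : b \in A by [].
rewrite finset.inE => /connectP[p /(pathP p a (component_id _ _))[C joinC] bE].
exists C; first by exists b; rewrite bE.
by case: joinC => _ _ _; apply; rewrite -bE.
Qed.

End Surfaces.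

(** * The component that carries the boundary *)

Lemma ambient_isotopic_refl (R : realType) (K : set 'rV[R]_3) :
  ambient_isotopic K K.
Proof.
exists (fun _ p => p); split=> //.
- by apply: continuous_subspaceT => x; exact: cvg_snd.
- by move=> t _; exists id; split=> // p; exact: cvg_id.
- exact: image_id.
Qed.

Lemma orientationS (V : finType) (A T : {set {set V}}) (o : {set V} -> {perm V}) :
  A \subset T -> orientation T o -> orientation A o.
Proof.
move=> /fintype.subsetP AT [cyc opp]; split=> [a x /AT|a b x /AT aT /AT]; first exact: cyc.
exact: opp.
Qed.

(* The boundaries of a component and of its complement are disjoint closed sets
   covering the connected curve, so one of them is empty. *)
Lemma boundary_component (R : realType) (S : complex R)
    (A : {set {set vtx S}}) : simplicial S -> connected (boundary S) ->
  union_of_components (triangles S) A ->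
  (boundary (subcomplex A) !=set0)%classic ->
  boundary (subcomplex A) = boundary S.
Proof.
move=> simpS conS compA neA.
have disj : (boundary (subcomplex A) `&`
    boundary (subcomplex (triangles S :\: A)%SET) = set0)%classic.
  rewrite -subset0 => p [/boundary_sub_space Ap /boundary_sub_space Bp].
  by rewrite -(space_component_disjoint simpS compA).
have sub : boundary (subcomplex A) =
    (boundary S `&` boundary (subcomplex A))%classic.
  by rewrite (boundary_components compA) setIC setIUr setIid disj setU0.
(* A nonempty relatively open and closed subset of a connected set is the whole set; openness comes
   from the closed boundary of the complement. *)
apply: conS => //; last by exists (boundary (subcomplex A)) => //; exact: closed_boundary.
exists (~` boundary (subcomplex (triangles S :\: A)%SET))%classic.
  exact/closed_openC/closed_boundary.
rewrite (boundary_components compA) setIUl setICr setU0.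
by apply/esym/setIidPl; rewrite -disjoints_subset.
Qed.

Theorem lemma3p1 (R : realType) (P : seq 'rV[R]_3) (g : nat)
    (S : complex R) (o : {set vtx S} -> {perm (vtx S)}) :
  embedded_polygon P ->
  has_knot_genus (polygon P) g ->
  pl_surface S ->
  orientation (triangles S) o ->
  boundary S = polygon P ->
  (4 * g + 1 <= #|triangles S|)%N.
Proof.
move=> [P3 _ _] [_ min_g] surfS oS bdS.
(* Any point of the polygon lies on a boundary edge [e] of some triangle [a], whose component is the
   surface to be counted. *)
have [p] := polygon_nonempty (ltn_trans (isT : (0 < 2)%N) P3).
rewrite -bdS => -[e eB ep]; have [a aT ea] := boundary_edge_sub eB.
set A := component (triangles S) a.
have compA : union_of_components (triangles S) A := component_union aT.
have eA : e \in boundary_edges A.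
  by rewrite (boundary_edges_component compA (component_id _ a) ea).
have surfA := pl_surface_component compA surfS.
apply: leq_trans (subset_leq_card compA.1).
apply: genus_le_card surfA.2 _ _; first by apply/set0Pn; exists e.
apply: (min_g (subcomplex A)); split=> //.
- apply: (connected_space_component _ aT).
  by rewrite -card_gt0 (surfS.2.1 a aT).
- by exists o; exact: orientationS compA.1 oS.
(* The component bounds the polygon itself, so the constant isotopy serves. *)
- rewrite (@boundary_component _ S A surfS.1) //.
  + by rewrite bdS; exact: ambient_isotopic_refl.
  + by rewrite bdS; exact: connected_polygon.
  + by exists p; exists e.
Qed.
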